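(* Let $\mathcal{A}\in\mathbb{S}^{[m,n]}$, and let $\mathcal{B}\in\mathbb{S}_+^{[m',n]}$ with $m'$ even. Let $\{x_k\}$ and $\{d_k\}$ be (infinite) sequences generated by the feasible conjugate gradient (FCG) algorithm described in the context. Then $$\liminf_{k\to\infty}\|F(x_k)\|=0,$$ where $F(x)=\mathcal{A}x^{m-1}-(\mathcal{A}x^m)\,\mathcal{B}x^{m'-1}$.
   Context: Let $m,n,m'$ be positive integers. $\mathbb{R}^{[m,n]}$ is the set of real tensors $\mathcal{A}=(a_{i_1\ldots i_m})$ of order $m$ and dimension $n$ (indices in $\{1,\dots,n\}$), and $\mathbb{R}^{[1,n]}=\mathbb{R}^n$. For $x\in\mathbb{R}^n$, $\mathcal{A}x^m:=\sum_{i_1,\dots,i_m=1}^n a_{i_1\ldots i_m}x_{i_1}\cdots x_{i_m}\in\mathbb{R}$. $\mathcal{A}x^{m-1}\in\mathbb{R}^n$ is the vector with entries $(\mathcal{A}x^{m-1})_i=\sum_{j_1,\dots,j_{m-1}=1}^n a_{ij_1\ldots j_{m-1}}x_{j_1}\cdots x_{j_{m-1}}$. The same notation is used for $\mathcal{B}$ with $m'$ in place of $m$. $\mathcal{A}$ is symmetric if its entries are invariant under all permutations of the indices. $\mathbb{S}^{[m,n]}$ is the set of symmetric tensors in $\mathbb{R}^{[m,n]}$. $\mathbb{S}_+^{[m,n]}$ is the set of positive definite ones, i.e. those with $\mathcal{A}x^m>0$ for all $x\in\mathbb{R}^n\setminus\{0\}$. $\|\cdot\|$ is the Euclidean norm.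 For $y\in\mathbb{R}^n$, $\|y\|_{\mathcal{B}}:=(\mathcal{B}y^{m'})^{1/m'}$. Put $f(x)=\frac1m\mathcal{A}x^m$ and $\mathbb{B}=\{x\in\mathbb{R}^n\mid\mathcal{B}x^{m'}=1\}$. FCG algorithm. Constants: $\rho\in(0,1)$, $\sigma_1\in(0,1)$, $\sigma_2>0$, $\delta>0$. Given an initial $u_0\in\mathbb{R}^n\setminus\{0\}$, set $x_0=u_0/\|u_0\|_{\mathcal{B}}$, $\lambda_0=\mathcal{A}x_0^m$ and $k=0$. While $F(x_k)\ne0$, perform the following steps. 1. Set $d_0=-F(x_0)$ if $k=0$. If $k>0$, set $$d_k=-F(x_k)+\beta_{k-1}d_{k-1}-\theta_{k-1}y_{k-1},$$ $$y_{k-1}=F(x_k)-F(x_{k-1}),\quad \beta_{k-1}=\frac{F(x_k)^\top y_{k-1}}{\|F(x_{k-1})\|^2},\quad \theta_{k-1}=\frac{F(x_k)^\top d_{k-1}}{\|F(x_{k-1})\|^2}.$$ 2. With $x_k(\alpha):=\dfrac{x_k+\alpha d_k}{\|x_k+\alpha d_k\|_{\mathcal{B}}}$, let $\alpha_k$ be the largest element of $\{\delta\rho^i\mid i=0,1,2,\dots\}$ satisfying $$f(x_k(\alpha_k))\le f(x_k)+\sigma_1\alpha_kF(x_k)^\top d_k-\sigma_2\alpha_k^2\|d_k\|^2.$$ 3. Set $x_{k+1}=x_k(\alpha_k)$ and $\lambda_{k+1}=\mathcal{A}x_{k+1}^m$, and replace $k$ by $k+1$. The algorithm stops if $F(x_k)=0$.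 The statement concerns the case where it does not stop, so that the generated sequences are infinite. *)

(* Defs.v *)
From HB Require Import structures.
From mathcomp Require Import all_boot all_order all_algebra all_fingroup.
From mathcomp Require Import all_classical all_reals all_analysis.

Set Implicit Arguments.
Unset Strict Implicit.
Unset Printing Implicit Defensive.

Import Order.TTheory GRing.Theory Num.Theory.

Local Open Scope ring_scope.

Definition tensor (R : Type) (m n : nat) := {ffun m.-tuple 'I_n -> R}.

(* [permute_index s t] is the multi-index (t_{s 0}, ..., t_{s (m-1)}). *)
Definition permute_index (m n : nat) (s : 'S_m) (t : m.-tuple 'I_n) :
    m.-tuple 'I_n :=
  [tuple tnth t (s j) | j < m].

Definition symmetric_tensor (R : Type) (m n : nat) (A : tensor R m n) : Prop :=
  forall (s : 'S_m) (t : m.-tuple 'I_n), A (permute_index s t) = A t.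

(* The scalar A x^m. *)
Definition tensor_form (R : realType) (m n : nat) (A : tensor R m n)
    (x : 'cV[R]_n) : R :=
  \sum_(t : m.-tuple 'I_n) A t * \prod_(j < m) x (tnth t j) 0.

(* The vector A x^(m-1), for A of order m = p.+1: the first index is free and
   the remaining p indices are contracted with x. *)
Definition tensor_vec (R : realType) (p n : nat) (A : tensor R p.+1 n)
    (x : 'cV[R]_n) : 'cV[R]_n :=
  \col_i \sum_(t : p.-tuple 'I_n)
    A [tuple of i :: t] * \prod_(j < p) x (tnth t j) 0.

Definition posdef_tensor (R : realType) (m n : nat) (A : tensor R m n) : Prop :=
  forall x : 'cV[R]_n, x != 0 -> 0 < tensor_form A x.

Definition dot (R : realType) (n : nat) (u v : 'cV[R]_n) : R :=
  \sum_(i < n) u i 0 * v i 0.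

(* Euclidean norm; the library norm `|_| on matrices is the max norm. *)
Definition l2norm (R : realType) (n : nat) (u : 'cV[R]_n) : R :=
  Num.sqrt (dot u u).

Definition Bnorm (R : realType) (m n : nat) (B : tensor R m n)
    (y : 'cV[R]_n) : R :=
  powR (tensor_form B y) (m%:R^-1).

Definition fobj (R : realType) (m n : nat) (A : tensor R m n)
    (x : 'cV[R]_n) : R :=
  m%:R^-1 * tensor_form A x.

Definition Fmap (R : realType) (p q n : nat) (A : tensor R p.+1 n)
    (B : tensor R q.+1 n) (x : 'cV[R]_n) : 'cV[R]_n :=
  tensor_vec A x - tensor_form A x *: tensor_vec B x.

(* The curve alpha |-> (x + alpha d) / ||x + alpha d||_B. *)
Definition feasible_curve (R : realType) (m n : nat) (B : tensor R m n)
    (x d : 'cV[R]_n) (alpha : R) : 'cV[R]_n :=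
  (Bnorm B (x + alpha *: d))^-1 *: (x + alpha *: d).

Definition sufficient_decrease (R : realType) (p q n : nat)
    (A : tensor R p.+1 n) (B : tensor R q.+1 n) (sigma1 sigma2 : R)
    (x d : 'cV[R]_n) (alpha : R) : Prop :=
  fobj A (feasible_curve B x d alpha) <=
    fobj A x + sigma1 * alpha * dot (Fmap A B x) d
    - sigma2 * alpha ^+ 2 * l2norm d ^+ 2.

(* [alpha] is the largest element of {delta rho^i | i = 0, 1, 2, ...} that
   satisfies [P]. *)
Definition largest_step (R : realType) (rho delta : R) (P : R -> Prop)
    (alpha : R) : Prop :=
  [/\ exists i : nat, alpha = delta * rho ^+ i,
      P alpha &
      forall i : nat, P (delta * rho ^+ i) -> delta * rho ^+ i <= alpha].

(* An infinite (non-terminating) run of the FCG algorithm started at [u0]. *)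
Record FCG_run (R : realType) (p q n : nat) (A : tensor R p.+1 n)
    (B : tensor R q.+1 n) (rho sigma1 sigma2 delta : R) (u0 : 'cV[R]_n)
    (x d : nat -> 'cV[R]_n) (alpha lambda : nat -> R) : Prop := {
  FCG_u0 : u0 != 0;
  FCG_x0 : x 0%N = (Bnorm B u0)^-1 *: u0;
  FCG_lambda : forall k, lambda k = tensor_form A (x k);
  FCG_nonstop : forall k, Fmap A B (x k) != 0;
  FCG_d0 : d 0%N = - Fmap A B (x 0%N);
  FCG_dS : forall k,
    let y := Fmap A B (x k.+1) - Fmap A B (x k) in
    let beta := dot (Fmap A B (x k.+1)) y / l2norm (Fmap A B (x k)) ^+ 2 in
    let theta :=
      dot (Fmap A B (x k.+1)) (d k) / l2norm (Fmap A B (x k)) ^+ 2 in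
    d k.+1 = - Fmap A B (x k.+1) + beta *: d k - theta *: y;
  FCG_alpha : forall k,
    largest_step rho delta
      (sufficient_decrease A B sigma1 sigma2 (x k) (d k)) (alpha k);
  FCG_xS : forall k, x k.+1 = feasible_curve B (x k) (d k) (alpha k)
}.

(* Main.v *)
(** Along a run [F(x_k)^T d_k = - |F(x_k)|^2], and [F(x)] is the gradient at a
    point [x] of the level set [B x^m' = 1] of [f] composed with the
    normalization [z |-> z / |z|_B]; the error of the corresponding first-order
    expansion is at most [C |h|^2], uniformly in [x].  Suppose [|F(x_k)| >= e]
    from some index on.  The accepted decreases are summable, so [alpha_k] and
    [alpha_k |d_k|] tend to 0.  Hence [y_k] tends to 0, so eventually
    [|d_(k+1)| <= M + |d_k| / 2] and the directions are bounded.  Eventually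
    [alpha_k < delta], so the step [alpha_k / rho] was rejected, and the uniform
    expansion then bounds [alpha_k] from below: a contradiction. *)
Require Import Defs.
From HB Require Import structures.
From mathcomp Require Import all_boot all_order all_algebra all_fingroup.
From mathcomp Require Import all_classical all_reals all_analysis.
From mathcomp Require Import ring lra.
Import Order.TTheory GRing.Theory Num.Theory.
Import numFieldNormedType.Exports.
Local Open Scope ring_scope.

Set Implicit Arguments.
Unset Strict Implicit.
Unset Printing Implicit Defensive.

(** * Euclidean inner product and norm on column vectors *)

Section EuclideanSpace.
Context {R : realType} {n : nat}.
Implicit Types (u v w : 'cV[R]_n) (c : R).

Lemma dotC u v : dot u v = dot v u.
Proof. by apply: eq_bigr => i _; rewrite mulrC. Qed.

Lemma dotDr u v w : dot u (v + w) = dot u v + dot u w.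
Proof. by rewrite -big_split; apply: eq_bigr => i _; rewrite mxE mulrDr. Qed.

Lemma dotZr c u v : dot u (c *: v) = c * dot u v.
Proof. by rewrite [RHS]mulr_sumr; apply: eq_bigr => i _; rewrite mxE mulrCA. Qed.

Lemma dotNr u v : dot u (- v) = - dot u v.
Proof. by rewrite -scaleN1r dotZr mulN1r. Qed.

Lemma dotDl u v w : dot (u + v) w = dot u w + dot v w.
Proof. by rewrite dotC dotDr !(dotC w). Qed.

Lemma dotZl c u v : dot (c *: u) v = c * dot u v.
Proof. by rewrite dotC dotZr dotC. Qed.

Lemma dotNl u v : dot (- u) v = - dot u v.
Proof. by rewrite dotC dotNr dotC. Qed.

Lemma dot_ge0 u : 0 <= dot u u.
Proof. by apply: sumr_ge0 => i _; rewrite -expr2 sqr_ge0. Qed.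

Lemma l2norm_ge0 u : 0 <= l2norm u.
Proof. exact: sqrtr_ge0. Qed.

Lemma sqr_l2norm u : l2norm u ^+ 2 = dot u u.
Proof. by rewrite sqr_sqrtr // dot_ge0. Qed.

Lemma coord_le_l2norm u i : `|u i 0| <= l2norm u.
Proof.
rewrite -(sqrtr_sqr (u i 0)) ler_wsqrtr // /dot (bigD1 i) //= -expr2 lerDl.
by apply: sumr_ge0 => j _; rewrite -expr2 sqr_ge0.
Qed.

Lemma l2norm_eq0 u : (l2norm u == 0) = (u == 0).
Proof.
apply/eqP/eqP => [u0|->].
  apply/matrixP => i j; rewrite ord1 mxE; apply/eqP.
  by rewrite -normr_le0 -u0 coord_le_l2norm.
by rewrite /l2norm /dot big1 ?sqrtr0 // => i _; rewrite mxE mul0r.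
Qed.

Lemma l2norm_gt0 u : (0 < l2norm u) = (u != 0).
Proof. by rewrite lt_def l2norm_eq0 l2norm_ge0 andbT. Qed.

Lemma l2normZ c u : l2norm (c *: u) = `|c| * l2norm u.
Proof. by rewrite /l2norm dotZl dotZr mulrA -expr2 sqrtrM ?sqr_ge0 // sqrtr_sqr. Qed.

Lemma l2normN u : l2norm (- u) = l2norm u.
Proof. by rewrite -scaleN1r l2normZ normrN1 mul1r. Qed.

(** For [v != 0], the squared norm of [dot v v *: u - dot u v *: v] is nonnegative and equals
    [dot v v] times the gap between the two squared sides. *)
Lemma cauchy_schwarz u v : `|dot u v| <= l2norm u * l2norm v.
Proof.
have [->|v0] := eqVneq v 0.
  have -> : (0 : 'cV[R]_n) = 0 *: v by rewrite scale0r.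
  by rewrite dotZr l2normZ normr0 !mul0r mulr0 normr0.
have vv : 0 < dot v v by rewrite -sqr_l2norm exprn_gt0 // l2norm_gt0.
rewrite -[leLHS]sqrtr_sqr -sqrtrM ?dot_ge0 // ler_wsqrtr //.
have := dot_ge0 (dot v v *: u - dot u v *: v).
rewrite !(dotDl, dotDr, dotNl, dotNr, dotZl, dotZr) (dotC v u) => H.
have : 0 <= dot v v * (dot u u * dot v v - dot u v ^+ 2) by nra.
by rewrite pmulr_rge0 // subr_ge0.
Qed.

Lemma ler_l2normD u v : l2norm (u + v) <= l2norm u + l2norm v.
Proof.
rewrite -ler_sqr ?nnegrE ?addr_ge0 ?l2norm_ge0 // sqr_l2norm.
rewrite dotDl !dotDr (dotC v u) sqrrD !sqr_l2norm.
by have := ler_norm (dot u v); have := cauchy_schwarz u v; lra.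
Qed.

Lemma ler_l2normB u v : l2norm (u - v) <= l2norm u + l2norm v.
Proof. by rewrite -(l2normN v) ler_l2normD. Qed.

(** Serves to pass from coordinatewise estimates of [Fmap] to its Euclidean norm. *)
Lemma l2norm_le_sum u : l2norm u <= \sum_i `|u i 0|.
Proof.
rewrite -ler_sqr ?nnegrE ?l2norm_ge0 ?sumr_ge0 // sqr_l2norm expr2 mulr_suml.
apply: ler_sum => i _; rewrite -expr2 -real_normK ?num_real // expr2.
by rewrite ler_wpM2l // (bigD1 i) //= lerDl sumr_ge0.
Qed.

End EuclideanSpace.

(** * First-order expansion of products and of symmetric forms *)

(* In the product rule the factor [j] of the [i]-th summand is [b j] when
   [j = i] and [a j] otherwise, so the sum over [i] is the linear part. *)
Lemma prod_taylor (R : realType) (M : R) m (a b : 'I_m -> R) e :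
  0 <= M -> 0 <= e <= 1 ->
  (forall j, `|a j| <= M) -> (forall j, `|b j| <= e) ->
  let L := \sum_i \prod_j (if j == i then b j else a j) in
  [/\ `|\prod_j a j| <= (M + 2) ^+ m,
      `|L| <= (M + 2) ^+ m * e &
      `|\prod_j (a j + b j) - \prod_j a j - L| <= (M + 2) ^+ m * e ^+ 2].
Proof.
move=> M0 /andP[e0 e1]; elim: m a b => [|m IH] a b ha hb L.
  rewrite /L !big_ord0 subrr subr0 normr0 normr1 mul1r.
  by split => //; rewrite mul1r sqr_ge0.
pose a' j := a (lift ord0 j); pose b' j := b (lift ord0 j).
have [] := IH a' b' (fun j => ha _) (fun j => hb _).
set L' := \sum_i _ => hP hL hR.
have LE : L = b ord0 * \prod_j a' j + a ord0 * L'.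
  rewrite /L big_ord_recl big_ord_recl eqxx; congr (_ + _).
  rewrite mulr_sumr; apply: eq_bigr => i _; rewrite big_ord_recl.
  by congr (_ * _); apply: eq_bigr => j _; rewrite (inj_eq lift_inj).
have ha0 := ha ord0; have hb0 := hb ord0.
have M2 : 0 <= (M + 2) ^+ m by rewrite exprn_ge0 //; lra.
rewrite LE !big_ord_recl -/a' exprS.
set K := (M + 2) ^+ m in hP hL hR M2 *; set P := \prod_j a' j in hP hR *.
set Q := \prod_j (a' j + b' j) in hR *.
have Ke : 0 <= K * e by rewrite mulr_ge0.
have Kee : 0 <= K * e ^+ 2 by rewrite mulr_ge0 ?sqr_ge0.
split.
- rewrite normrM; apply: (le_trans (ler_pM _ _ ha0 hP)) => //; nra.
- apply: (le_trans (ler_normD _ _)); rewrite !normrM.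
  have := ler_pM (normr_ge0 _) (normr_ge0 _) ha0 hL.
  have := ler_pM (normr_ge0 _) (normr_ge0 _) hb0 hP; nra.
(* The old remainder times the new factor costs [M + 1], and the product [b ord0 * L'] of two
   first-order terms costs 1; hence the base [M + 2]. *)
- have -> : (a ord0 + b ord0) * Q - a ord0 * P - (b ord0 * P + a ord0 * L') =
    (a ord0 + b ord0) * (Q - P - L') + b ord0 * L' by ring.
  apply: (le_trans (ler_normD _ _)); rewrite !normrM.
  have hab : `|a ord0 + b ord0| <= M + 1 by apply: (le_trans (ler_normD _ _)); lra.
  have := ler_pM (normr_ge0 _) (normr_ge0 _) hab hR.
  have := ler_pM (normr_ge0 _) (normr_ge0 _) hb0 hL; nra.
Qed.

Section TensorForm.
Context {R : realType} {n : nat}.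

Lemma tensor_formZ m (A : tensor R m n) c (x : 'cV[R]_n) :
  tensor_form A (c *: x) = c ^+ m * tensor_form A x.
Proof.
rewrite [RHS]mulr_sumr; apply: eq_bigr => t _; rewrite mulrCA; congr (_ * _).
under eq_bigr do rewrite mxE.
by rewrite big_split /= prodr_const card_ord.
Qed.

Lemma sum_tuple_cons p (G : p.+1.-tuple 'I_n -> R) :
  \sum_t G t = \sum_(i < n) \sum_(t : p.-tuple 'I_n) G [tuple of i :: t].
Proof.
rewrite pair_big /= (reindex (fun z : 'I_n * p.-tuple 'I_n => [tuple of z.1 :: z.2])) //=.
exists (fun t : p.+1.-tuple 'I_n => (thead t, [tuple of behead t])) => [[i t]|t] _ /=.
  by rewrite theadE; congr pair; apply: val_inj.
by rewrite [RHS]tuple_eta; apply: val_inj.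
Qed.

Lemma dot_tensor_vecE p (A : tensor R p.+1 n) (x h : 'cV[R]_n) :
  dot (tensor_vec A x) h =
  \sum_t A t * (h (tnth t ord0) 0 * \prod_(j < p) x (tnth t (lift ord0 j)) 0).
Proof.
rewrite sum_tuple_cons; apply: eq_bigr => i _; rewrite mxE mulr_suml.
apply: eq_bigr => t _; rewrite -mulrA [_ * h _ _]mulrC; congr (_ * (_ * _)).
by apply: eq_bigr => j _; congr (x _ _); rewrite tnthS.
Qed.

Lemma dot_tensor_vec_id p (A : tensor R p.+1 n) (x : 'cV[R]_n) :
  dot (tensor_vec A x) x = tensor_form A x.
Proof. by rewrite dot_tensor_vecE; apply: eq_bigr => t _; rewrite big_ord_recl. Qed.

Lemma permute_index_bij m (s : 'S_m) :
  bijective (permute_index (n:=n) s).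
Proof.
exists (permute_index (s^-1)%g) => t; apply: eq_from_tnth => j;
  by rewrite !tnth_mktuple ?permK ?permKV.
Qed.

(** By symmetry, the transposition of [ord0] and [i] moves the factor [h] from the first position to
    position [i], and there are [p.+1] positions. The right-hand side is the linear part in
    [prod_taylor]. *)
Lemma dot_tensor_vec_sym p (A : tensor R p.+1 n) (x h : 'cV[R]_n) :
  symmetric_tensor A ->
  p.+1%:R * dot (tensor_vec A x) h =
  \sum_t A t * \sum_i
    \prod_j (if j == i then h (tnth t j) 0 else x (tnth t j) 0).
Proof.
move=> symA; under eq_bigr do rewrite mulr_sumr.
rewrite exchange_big /= mulr_natl -[in LHS](card_ord p.+1) -sumr_const.
apply: eq_bigr => i _; rewrite dot_tensor_vecE.
rewrite (reindex _ (onW_bij _ (permute_index_bij (tperm ord0 i)))) /=.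
apply: eq_bigr => t _; rewrite symA; congr (_ * _).
rewrite [RHS](reindex_inj (@perm_inj _ (tperm ord0 i))) big_ord_recl.
rewrite tpermL eqxx !tnth_mktuple tpermL; congr (_ * _).
apply: eq_bigr => j _; rewrite tnth_mktuple.
by rewrite -[X in _ == X](tpermL ord0 i) (inj_eq perm_inj).
Qed.

(** [prod_taylor] is applied to each monomial, with [e] the norm of [h], and summed with weights
    [A t]. *)
Lemma tensor_form_taylor p (A : tensor R p.+1 n) (M : R) :
  symmetric_tensor A -> 0 <= M ->
  exists2 C : R, 0 <= C & forall x h, l2norm x <= M -> l2norm h <= 1 ->
  [/\ `|tensor_form A x| <= C,
      `|p.+1%:R * dot (tensor_vec A x) h| <= C * l2norm h &
      `|tensor_form A (x + h) - tensor_form A x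
          - p.+1%:R * dot (tensor_vec A x) h| <= C * l2norm h ^+ 2].
Proof.
move=> symA M0; exists ((\sum_t `|A t|) * (M + 2) ^+ p.+1).
  by rewrite mulr_ge0 ?sumr_ge0 // exprn_ge0 //; lra.
move=> x h xM h1.
have T (t : p.+1.-tuple 'I_n) := @prod_taylor R M _
  (fun j => x (tnth t j) 0) (fun j => h (tnth t j) 0) (l2norm h) M0
  (introT andP (conj (l2norm_ge0 h) h1))
  (fun j => le_trans (coord_le_l2norm _ _) xM) (fun j => coord_le_l2norm _ _).
rewrite dot_tensor_vec_sym // /tensor_form -!sumrB -!mulrA !mulr_suml.
split; apply: (le_trans (ler_norm_sum _ _ _)); apply: ler_sum => t _;
  have [hP hL hR] := T t.
- by rewrite normrM ler_wpM2l.
- by rewrite normrM ler_wpM2l.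
- rewrite -!mulrBr normrM ler_wpM2l //.
  by under [X in X - _ - _]eq_bigr do rewrite mxE.
Qed.

End TensorForm.

(** * Bounds and Lipschitz constants on balls *)

Section LipschitzOn.
Context {R : realType} {n : nat}.
Implicit Types (f g : 'cV[R]_n -> R) (M c : R).

(** The bound on [f] is carried along with the Lipschitz constant, so that the class is closed under
    products. *)
Definition lipschitz_on_ball M f := exists2 C : R, 0 <= C &
  forall x y, l2norm x <= M -> l2norm y <= M ->
    `|f x| <= C /\ `|f x - f y| <= C * l2norm (x - y).

Lemma lipschitz_on_ball_cst M c : lipschitz_on_ball M (fun=> c).
Proof.
exists `|c| => // x y _ _; split=> //.
by rewrite subrr normr0 mulr_ge0 // l2norm_ge0.
Qed.

Lemma lipschitz_on_ball_coord M i : lipschitz_on_ball M (fun x => x i 0).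
Proof.
exists (Num.max 1 M) => [|x y xM _]; first by rewrite le_max ler01.
split; first by rewrite le_max (le_trans (coord_le_l2norm x i) xM) orbT.
have := coord_le_l2norm (x - y) i; rewrite !mxE => /le_trans; apply.
by rewrite ler_peMl ?l2norm_ge0 // le_max lexx.
Qed.

Lemma lipschitz_on_ballD M f g :
  lipschitz_on_ball M f -> lipschitz_on_ball M g ->
  lipschitz_on_ball M (fun x => f x + g x).
Proof.
move=> [C C0 hf] [D D0 hg]; exists (C + D) => [|x y xM yM]; first exact: addr_ge0.
have [f1 f2] := hf x y xM yM; have [g1 g2] := hg x y xM yM; split.
  exact: le_trans (ler_normD _ _) (lerD f1 g1).
by rewrite opprD addrACA mulrDl (le_trans (ler_normD _ _)) ?lerD.
Qed.

Lemma lipschitz_on_ballM M f g :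
  lipschitz_on_ball M f -> lipschitz_on_ball M g ->
  lipschitz_on_ball M (fun x => f x * g x).
Proof.
move=> [C C0 hf] [D D0 hg]; exists (C * D *+ 2) => [|x y xM yM].
  by rewrite mulrn_wge0 // mulr_ge0.
have [f1 f2] := hf x y xM yM; have [g1 _] := hg x y xM yM.
have [_ g2] := hg x y xM yM; have [fy _] := hf y x yM xM.
have CD : 0 <= C * D by rewrite mulr_ge0.
split.
  by rewrite normrM (le_trans (ler_pM _ _ f1 g1)) // mulr2n lerDl.
have -> : f x * g x - f y * g y = (f x - f y) * g x + f y * (g x - g y) by ring.
rewrite (le_trans (ler_normD _ _)) // !normrM.
have := ler_pM (normr_ge0 _) (normr_ge0 _) f2 g1.
have := ler_pM (normr_ge0 _) (normr_ge0 _) fy g2; lra.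
Qed.

Lemma lipschitz_on_ball_sum M I (r : seq I) (P : pred I) (f : I -> 'cV[R]_n -> R) :
  (forall i, lipschitz_on_ball M (f i)) ->
  lipschitz_on_ball M (fun x => \sum_(i <- r | P i) f i x).
Proof.
move=> hf; elim: r => [|i r IH].
  by under eq_fun do rewrite big_nil; apply: lipschitz_on_ball_cst.
under eq_fun do rewrite big_cons.
by case: (P i) => //; apply: lipschitz_on_ballD.
Qed.

Lemma lipschitz_on_ball_prod M I (r : seq I) (P : pred I) (f : I -> 'cV[R]_n -> R) :
  (forall i, lipschitz_on_ball M (f i)) ->
  lipschitz_on_ball M (fun x => \prod_(i <- r | P i) f i x).
Proof.
move=> hf; elim: r => [|i r IH].
  by under eq_fun do rewrite big_nil; apply: lipschitz_on_ball_cst.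
under eq_fun do rewrite big_cons.
by case: (P i) => //; apply: lipschitz_on_ballM.
Qed.

Lemma lipschitz_on_ball_tensor_form M m (A : tensor R m n) :
  lipschitz_on_ball M (tensor_form A).
Proof.
apply: lipschitz_on_ball_sum => t; apply: lipschitz_on_ballM.
  exact: lipschitz_on_ball_cst.
by apply: lipschitz_on_ball_prod => j; apply: lipschitz_on_ball_coord.
Qed.

Lemma lipschitz_on_ball_tensor_vec M p (A : tensor R p.+1 n) i :
  lipschitz_on_ball M (fun x => tensor_vec A x i 0).
Proof.
under eq_fun do rewrite mxE.
apply: lipschitz_on_ball_sum => t; apply: lipschitz_on_ballM.
  exact: lipschitz_on_ball_cst.
by apply: lipschitz_on_ball_prod => j; apply: lipschitz_on_ball_coord.
Qed.

Lemma lipschitz_on_ball_Fmap M p q (A : tensor R p.+1 n) (B : tensor R q.+1 n) :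
  exists2 C : R, 0 <= C & forall x y, l2norm x <= M -> l2norm y <= M ->
    l2norm (Fmap A B x) <= C /\
    l2norm (Fmap A B x - Fmap A B y) <= C * l2norm (x - y).
Proof.
have hF i : exists C : R, 0 <= C /\ forall x y, l2norm x <= M -> l2norm y <= M ->
    `|Fmap A B x i 0| <= C /\
    `|Fmap A B x i 0 - Fmap A B y i 0| <= C * l2norm (x - y).
  have [C C0 hC] : lipschitz_on_ball M (fun x => Fmap A B x i 0); last by exists C.
  have -> : (fun x => Fmap A B x i 0) = (fun x =>
      tensor_vec A x i 0 + (-1 * tensor_form A x) * tensor_vec B x i 0).
    by apply/funext => x; rewrite /Fmap !mxE mulN1r mulNr.
  apply: lipschitz_on_ballD; first exact: lipschitz_on_ball_tensor_vec.
  apply: lipschitz_on_ballM; last exact: lipschitz_on_ball_tensor_vec.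
  apply: lipschitz_on_ballM; first exact: lipschitz_on_ball_cst.
  exact: lipschitz_on_ball_tensor_form.
have [C hC] := choice hF.
exists (\sum_i C i) => [|x y xM yM].
  by apply: sumr_ge0 => i _; have [] := hC i.
split; apply: (le_trans (l2norm_le_sum _)); last rewrite mulr_suml;
  apply: ler_sum => i _; have [_ /(_ x y xM yM)[]] := hC i => //.
by rewrite [(_ - Fmap A B y) i 0]mxE [(- Fmap A B y) i 0]mxE.
Qed.

End LipschitzOn.

(** * Coercivity of positive definite forms *)

Section PositiveDefinite.
Context {R : realType} {n : nat}.

Lemma continuous_tensor_form_tr m (A : tensor R m n) :
  continuous (fun v : 'rV[R]_n => tensor_form A v^T).
Proof.
apply: continuous_big => [|t _]; first exact: add_continuous.
move=> v; apply: continuousM; first exact: cst_continuous.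
apply: continuous_big v => [|j _]; first exact: mul_continuous.
by under eq_fun do rewrite mxE; apply: coord_continuous.
Qed.

(** The constant [c] is the minimum of the form on the Euclidean unit sphere [S], which is compact;
    homogeneity extends the bound to all [x != 0]. *)
Lemma posdef_tensor_coercive m (B : tensor R m n) :
  (0 < n)%N -> posdef_tensor B ->
  exists2 c : R, 0 < c & forall x, x != 0 -> c * l2norm x ^+ m <= tensor_form B x.
Proof.
move=> n0 Bpos.
pose S := [set v : 'rV[R]_n | dot v^T v^T = 1]%classic.
have dot_cont : continuous (fun v : 'rV[R]_n => dot v^T v^T).
  apply: continuous_big => [|i _]; first exact: add_continuous.
  under eq_fun do rewrite mxE.
  by move=> v; apply: continuousM; apply: coord_continuous.
have Snonempty : (S !=set0)%classic.
  exists (delta_mx 0 (Ordinal n0)); rewrite /S /= /dot (bigD1 (Ordinal n0)) //=.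
  rewrite !mxE !eqxx mulr1 big1 ?addr0 // => i /negbTE ni.
  by rewrite !mxE ni andbF mul0r.
have Scompact : compact S.
  apply: bounded_closed_compact; last first.
    apply: (@preimage_closed _ _ (fun v : 'rV[R]_n => dot v^T v^T) [set 1]%classic).
      by move=> v _; apply: dot_cont.
    exact: closed_eq.
  exists 1; split; first exact: num_real.
  (* The norm to be bounded is the max norm; each coordinate is at most the Euclidean norm, which is
     1 on [S]. *)
  move=> M M1 v /= vS; rewrite [leLHS]/Num.Def.normr /= mx_normrE.
  apply: bigmax_le => [|[i j] _ /=]; first exact: le_trans (ltW M1).
  rewrite (le_trans _ (ltW M1)) // ord1 -[v 0 j]/(v 0 j).
  have := coord_le_l2norm v^T j.
  by rewrite mxE /l2norm vS sqrtr1.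
have [v0 v0S v0min] := EVT_min_rV Snonempty Scompact
  (continuous_subspaceT (@continuous_tensor_form_tr _ B)).
exists (tensor_form B v0^T).
  apply: Bpos; apply/eqP => v00; move: v0S; rewrite inE /S /= v00 => /esym/eqP.
  by rewrite -sqr_l2norm (eqP (_ : l2norm 0 == 0)) ?l2norm_eq0 // expr0n oner_eq0.
move=> x x0; have xgt0 : 0 < l2norm x by rewrite l2norm_gt0.
have /v0min : (((l2norm x)^-1 *: x)^T : 'rV_n) \in S.
  rewrite inE /S /= trmxK dotZl dotZr -sqr_l2norm mulrA -expr2 exprVn mulVf //.
  by rewrite expf_neq0 ?gt_eqF.
rewrite trmxK tensor_formZ => hmin.
rewrite mulrC -ler_pdivlMl ?exprn_gt0 // -exprVn //.
Qed.

(** A norm above 1 is at most its power [q.+1], hence at most [c^-1] by coercivity. *)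
Lemma posdef_level_set_bounded q (B : tensor R q.+1 n) :
  (0 < n)%N -> posdef_tensor B ->
  exists2 M : R, 0 <= M & forall x, tensor_form B x = 1 -> l2norm x <= M.
Proof.
move=> n0 /(posdef_tensor_coercive n0)[c c0 hc].
have ci : 0 < c^-1 by rewrite invr_gt0.
exists (1 + c^-1) => [|x x1]; first by rewrite addr_ge0 // ltW.
have [x0|x0] := eqVneq x 0.
  by rewrite x0 (eqP (_ : l2norm 0 == 0)) ?l2norm_eq0 // addr_ge0 // ltW.
have [xle|xgt] := leP (l2norm x) 1; first by rewrite (le_trans xle) // lerDl ltW.
have := hc x x0; rewrite x1 -ler_pdivlMl // mulr1 => h.
rewrite (le_trans _ (_ : c^-1 <= _)) ?lerDr // (le_trans _ h) //.
by rewrite exprS ler_peMr ?l2norm_ge0 // exprn_ege1 // ltW.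
Qed.

End PositiveDefinite.

(** * Expansion of the objective along the normalized curve *)

(* The logarithm lies between [u / (1 + u)] and [u], and the exponential
   of [y] is at least [1 + y]. *)
Lemma powRN_taylor1 (R : realType) (K a u : R) :
  0 <= a <= K -> `|u| <= (4 * (K + 1))^-1 ->
  `|(1 + u) `^ (- a) - 1 + a * u| <= 8 * (K + 1) ^+ 2 * u ^+ 2.
Proof.
move=> /andP[a0 aK] hu.
have K1 : 1 <= K + 1 by lra.
have hu4 : `|u| <= 1 / 4.
  by rewrite (le_trans hu) // invfM mul1r ler_piMr // invf_le1; lra.
have auK : `|a * u| <= 1 / 4.
  rewrite normrM (ger0_norm a0) (le_trans (ler_pM a0 (normr_ge0 _) aK hu)) //.
  by rewrite ler_pdivrMr; lra.
have hu4' : - (1/4) <= u <= 1/4 by rewrite -ler_norml.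
have au4' : - (1/4) <= a * u <= 1/4 by rewrite -ler_norml.
have s0 : 0 < 1 + u by lra.
have L1 : ln (1 + u) <= u by apply: le_ln1Dx; lra.
have L2 : u / (1 + u) <= ln (1 + u).
  (* The lower bound on the logarithm is the upper bound taken at the inverse. *)
  have : ln (1 + u)^-1 <= (1 + u)^-1 - 1.
    rewrite -[X in ln X](subrK 1) addrC; apply: le_ln1Dx.
    by have := invr_gt0 (1 + u); rewrite s0 => /esym; lra.
  rewrite lnV ?posrE //.
  have -> : u / (1 + u) = 1 - (1 + u)^-1 by field; lra.
  lra.
rewrite /powR gt_eqF // mulNr.
(* [a * L] lies between [w] and [a * u], which differ by at most [2 * a * u ^+ 2]. *)
set L := ln (1 + u) in L1 L2 *; set w := a * (u / (1 + u)).
have aL1 : a * L <= a * u by rewrite ler_wpM2l.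
have aL2 : w <= a * L by rewrite ler_wpM2l.
have E1 := expR_ge1Dx (- (a * L)).
have wE : a * u - w = a * u ^+ 2 / (1 + u) by rewrite /w; field; lra.
have wle : a * u ^+ 2 / (1 + u) <= 2 * a * u ^+ 2.
  have au2 : 0 <= a * u ^+ 2 by rewrite mulr_ge0 ?sqr_ge0.
  by rewrite ler_pdivrMr //; nra.
have wle0 : 0 <= a * u ^+ 2 / (1 + u).
  by rewrite divr_ge0 ?(ltW s0) // mulr_ge0 ?sqr_ge0.
have w_ge : - (1 / 2) <= w by rewrite /w mulrA ler_pdivlMr //; lra.
(* The bound [1 + y] on the exponential, taken at [a * L], is inverted; then [E3] truncates the
   geometric series. *)
have E2 : expR (- (a * L)) <= (1 + w)^-1.
  rewrite expRN lef_pV2 ?posrE ?expR_gt0 //; last lra.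
  by rewrite (le_trans _ (expR_ge1Dx _)) // lerD2l.
have E3 : (1 + w)^-1 <= 1 - w + 2 * w ^+ 2.
  rewrite -[leLHS]mul1r ler_pdivrMr; last lra.
  have -> : (1 - w + 2 * w ^+ 2) * (1 + w) = 1 + w ^+ 2 * (1 + 2 * w) by ring.
  by rewrite lerDl mulr_ge0 ?sqr_ge0 //; lra.
have w2 : w ^+ 2 <= 2 * a ^+ 2 * u ^+ 2.
  rewrite /w mulrA expr_div_n exprMn ler_pdivrMr ?exprn_gt0 //.
  have : 0 <= a ^+ 2 * u ^+ 2 by rewrite mulr_ge0 ?sqr_ge0.
  have : 1 <= 2 * (1 + u) ^+ 2 by nra.
  nra.
have KK : (2 * a + 4 * a ^+ 2) * u ^+ 2 <= 8 * (K + 1) ^+ 2 * u ^+ 2.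
  by rewrite ler_wpM2r ?sqr_ge0 //; nra.
rewrite ger0_norm; lra.
Qed.

(** With [s] the value of the form of [B], this is a power of the normalizing factor: [i = m]
    rescales the form of [A], and [i = 1] the point itself. *)
Lemma powR_invnX (R : realType) (s : R) q i :
  0 <= s -> (s `^ q.+1%:R^-1)^-1 ^+ i = s `^ (- (i%:R / q.+1%:R)).
Proof.
by move=> s0; rewrite powRN exprVn mulrC powRrM powR_mulrn // powR_ge0.
Qed.

(* Here [P0 + l] and [1 + v] are the first-order parts of [A (x + h)^m] and
   [B (x + h)^m' = 1 + u], [phi] is [(1 + u)^(-a)] with [a = m / m'], and [e] is
   the norm of [h]. *)
Lemma product_taylor (R : realFieldType) (P P0 l u v phi a e CA CB K : R) :
  0 <= a -> 0 <= e <= 1 -> 0 <= CA -> 0 <= CB -> 0 <= K ->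
  `|P0| <= CA -> `|l| <= CA * e -> `|P - P0 - l| <= CA * e ^+ 2 ->
  `|v| <= CB * e -> `|u - v| <= CB * e ^+ 2 ->
  `|phi - 1 + a * u| <= K * u ^+ 2 ->
  `|phi * P - P0 - l + a * P0 * v| <=
    ((1 + 2 * a * CB + 4 * K * CB ^+ 2) * CA + 8 * K * CB ^+ 2 * CA
      + 3 * a * CA * CB) * e ^+ 2.
Proof.
move=> a0 /andP[e0 e1] CA0 CB0 K0 hP0 hl hP hv huv hphi.
have e21 : e ^+ 2 <= e by nra.
have hu : `|u| <= 2 * CB * e.
  have -> : u = (u - v) + v by ring.
  rewrite (le_trans (ler_normD _ _)) //.
  have : CB * e ^+ 2 <= CB * e by rewrite ler_wpM2l.
  lra.
have hu2 : u ^+ 2 <= 4 * CB ^+ 2 * e ^+ 2.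
  rewrite -(real_normK (num_real u)).
  have := ler_pM (normr_ge0 _) (normr_ge0 _) hu hu; lra.
have hphi2 : `|phi - 1 + a * u| <= 4 * K * CB ^+ 2 * e ^+ 2.
  by rewrite (le_trans hphi) //; have := ler_wpM2l K0 hu2; lra.
have CBe : 0 <= CB * e by rewrite mulr_ge0.
have hau : `|a * u| <= 2 * a * CB * e.
  by rewrite normrM (ger0_norm a0); have := ler_wpM2l a0 hu; lra.
have KC : 0 <= K * CB ^+ 2 by rewrite mulr_ge0 ?sqr_ge0.
have aC : 0 <= a * CB by rewrite mulr_ge0.
have hphi1 : `|phi| <= 1 + 2 * a * CB + 4 * K * CB ^+ 2.
  have -> : phi = (phi - 1 + a * u) + 1 - a * u by ring.
  rewrite (le_trans (ler_normB _ _)) // (le_trans (lerD (ler_normD _ _) (lexx _))) //.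
  rewrite normr1.
  have : K * CB ^+ 2 * e ^+ 2 <= K * CB ^+ 2 by rewrite ler_piMr //; lra.
  have : a * CB * e <= a * CB by rewrite ler_piMr.
  lra.
(* Each of the four terms is of second order: it contains a remainder or the product [u * l] of two
   first-order quantities. *)
have -> : phi * P - P0 - l + a * P0 * v =
  phi * (P - P0 - l) + (phi - 1 + a * u) * (P0 + l) - a * u * l
    - a * P0 * (u - v) by ring.
have hPl : `|P0 + l| <= 2 * CA.
  rewrite (le_trans (ler_normD _ _)) //.
  have : CA * e <= CA by rewrite ler_piMr.
  lra.
have haP : `|a * P0| <= a * CA by rewrite normrM (ger0_norm a0) ler_wpM2l.
have h1 := ler_pM (normr_ge0 _) (normr_ge0 _) hphi1 hP.
have h2 := ler_pM (normr_ge0 _) (normr_ge0 _) hphi2 hPl.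
have h3 := ler_pM (normr_ge0 _) (normr_ge0 _) hau hl.
have h4 := ler_pM (normr_ge0 _) (normr_ge0 _) haP huv.
rewrite (le_trans (ler_normB _ _)) // (le_trans (lerD (ler_normB _ _) (lexx _))) //.
rewrite (le_trans (lerD (lerD (ler_normD _ _) (lexx _)) (lexx _))) // !normrM.
move: h1 h2 h3 h4; rewrite !normrM; lra.
Qed.

(** Bounds the displacement [phi *: h + (phi - 1) *: x] of the curve, where [phi] is [(1 + u)^(-b)]
    with [b = 1 / m'], and [X] is the norm of [x]. *)
Lemma power_taylor (R : realFieldType) (u phi a b e CB K M X : R) :
  0 <= e <= 1 -> 0 <= CB -> 0 <= K -> 0 <= b <= a -> `|u| <= 2 * CB * e ->
  `|phi - 1 + b * u| <= K * u ^+ 2 -> 0 <= M -> 0 <= X -> X <= M ->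
  `|phi| * e + `|phi - 1| * X <=
    (1 + 2 * a * CB + 4 * K * CB ^+ 2) * (1 + M) * e.
Proof.
move=> /andP[e0 e1] CB0 K0 /andP[b0 ba] hu hphi M0 X0 XM.
pose G := 2 * a * CB + 4 * K * CB ^+ 2.
have a0 : 0 <= a by lra.
have G0 : 0 <= G by rewrite addr_ge0 // ?mulr_ge0 ?sqr_ge0.
have hu2 : u ^+ 2 <= 4 * CB ^+ 2 * e.
  rewrite -(real_normK (num_real u)).
  have := ler_pM (normr_ge0 _) (normr_ge0 _) hu hu.
  have : CB ^+ 2 * (e * e) <= CB ^+ 2 * e by rewrite ler_wpM2l ?sqr_ge0 // ler_piMr.
  lra.
have phi1 : `|phi - 1| <= G * e.
  have -> : phi - 1 = (phi - 1 + b * u) - b * u by ring.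
  rewrite (le_trans (ler_normB _ _)) // normrM (ger0_norm b0).
  have := ler_wpM2l K0 hu2; have := ler_pM b0 (normr_ge0 _) ba hu.
  rewrite /G; lra.
have phi0 : `|phi| <= 1 + G.
  rewrite -[phi](subrK 1) (le_trans (ler_normD _ _)) // normr1.
  have : G * e <= G by rewrite ler_piMr.
  lra.
have := ler_pM (normr_ge0 _) X0 phi1 XM.
have := ler_wpM2r e0 phi0; have := mulr_ge0 M0 e0.
rewrite /G; lra.
Qed.

Section Curve.
Context {R : realType} {p q n : nat} (A : tensor R p.+1 n) (B : tensor R q.+1 n).

Lemma tensor_form_normalized (z : 'cV[R]_n) :
  0 < tensor_form B z -> tensor_form B ((Bnorm B z)^-1 *: z) = 1.
Proof.
move=> z0; rewrite tensor_formZ powR_invnX ?(ltW z0) //.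
by rewrite divff // powR_inv1 ?(ltW z0) // mulVf // gt_eqF.
Qed.

(** On the curve the form of [A] is [A z^m] times [(B z^m')^(-m / m')] at [z = x + h]. The factor
    [m'] from differentiating the form of [B] cancels in the exponent, so the linear part is [m]
    times the inner product of [Fmap A B x] with [h]. *)
Lemma feasible_curve_taylor (M : R) :
  symmetric_tensor A -> symmetric_tensor B -> 0 <= M ->
  exists C r : R, [/\ 0 <= C, 0 < r & forall x d t,
    tensor_form B x = 1 -> l2norm x <= M -> l2norm (t *: d) <= r ->
    fobj A (feasible_curve B x d t) <=
      fobj A x + t * dot (Fmap A B x) d + C * l2norm (t *: d) ^+ 2 /\
    l2norm (feasible_curve B x d t - x) <= C * l2norm (t *: d)].
Proof.
move=> symA symB M0.
have [CA CA0 hA] := tensor_form_taylor symA M0.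
have [CB CB0 hB] := tensor_form_taylor symB M0.
pose m : R := p.+1%:R; pose m' : R := q.+1%:R.
have m1 : 1 <= m by rewrite ler1n.
have m'1 : 1 <= m' by rewrite ler1n.
pose a := m / m'.
have a0 : 0 <= a by rewrite divr_ge0 //; lra.
have ai : 0 <= 1 / m' <= a by rewrite divr_ge0 ?ler_wpM2r ?invr_ge0 //; lra.
pose K := 8 * (a + 1) ^+ 2.
have K0 : 0 <= K by rewrite mulr_ge0 ?sqr_ge0.
(* This makes [r <= 1] and [2 * CB * r] at most [(4 * (a + 1))^-1], the range of [powRN_taylor1]. *)
pose r := (1 + 2 * CB * (4 * (a + 1)))^-1.
have r0 : 0 < r by rewrite invr_gt0; nra.
pose C1 := (1 + 2 * a * CB + 4 * K * CB ^+ 2) * CA + 8 * K * CB ^+ 2 * CA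
      + 3 * a * CA * CB.
pose C2 := (1 + 2 * a * CB + 4 * K * CB ^+ 2) * (1 + M).
exists (C1 + C2), r.
have KC : 0 <= K * CB ^+ 2 by rewrite mulr_ge0 ?sqr_ge0.
have aC : 0 <= a * CB by rewrite mulr_ge0.
have C10 : 0 <= C1.
  have G0 : 0 <= (1 + 2 * a * CB + 4 * K * CB ^+ 2) * CA by rewrite mulr_ge0 //; lra.
  have := mulr_ge0 KC CA0; have := mulr_ge0 aC CA0; rewrite /C1; lra.
have C20 : 0 <= C2 by rewrite mulr_ge0 //; lra.
split => //; first exact: addr_ge0.
move=> x d t xB xM; set h := t *: d => hr; set e := l2norm h in hr *.
have e0 : 0 <= e := l2norm_ge0 h.
have e1 : e <= 1.
  rewrite (le_trans hr) // invf_le1; nra.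
have [A1 A2 A3] := hA x h xM e1; have [B1 B2 B3] := hB x h xM e1.
rewrite -/m -/m' -/e in A1 A2 A3 B1 B2 B3.
pose u := tensor_form B (x + h) - 1.
have uE : tensor_form B (x + h) = 1 + u by rewrite /u [RHS]addrC subrK.
rewrite uE xB (addrC 1) addrK in B3.
have e21 : CB * e ^+ 2 <= CB * e by rewrite ler_wpM2l //; nra.
have hu : `|u| <= 2 * CB * e.
  rewrite -[u](subrK (m' * dot (tensor_vec B x) h)).
  by rewrite (le_trans (ler_normD _ _)) //; lra.
have hua : `|u| <= (4 * (a + 1))^-1.
  have a4 : 0 < 4 * (a + 1) by lra.
  rewrite (le_trans hu) // -[leRHS]mul1r ler_pdivlMr //.
  have D0 : 0 < 1 + 2 * CB * (4 * (a + 1)) by nra.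
  move: hr; rewrite /r -[leRHS]mul1r ler_pdivlMr //; nra.
have u1 : 0 <= 1 + u.
  have a41 : (4 * (a + 1))^-1 <= 1 by rewrite invf_le1; lra.
  by have := le_trans hua a41; rewrite ler_norml; lra.
(* The exponent [- a] serves for the objective and [- (1 / m')] for the displacement; both get the
   same [K] since [1 / m' <= a]. *)
have ha := powRN_taylor1 (introT andP (conj a0 (lexx _))) hua.
have hi := powRN_taylor1 ai hua.
rewrite -/K in ha hi.
have NE i : (Bnorm B (x + h))^-1 ^+ i = (1 + u) `^ (- (i%:R / m')).
  by rewrite /Bnorm uE powR_invnX.
rewrite /feasible_curve -/h; split.
  rewrite /fobj tensor_formZ NE -/m -/a.
  have := product_taylor a0 (introT andP (conj e0 e1))
    CA0 CB0 K0 A1 A2 A3 B2 B3 ha.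
  rewrite -/C1; set X := _ `^ _ * _ => hX.
  have {hX} hX : X <= tensor_form A x + m * (t * dot (Fmap A B x) d) + C1 * e ^+ 2.
    move: (le_trans (ler_norm _) hX).
    rewrite -[t * _]dotZr -/h /Fmap dotDl dotNl dotZl /a.
    have -> : m / m' * tensor_form A x * (m' * dot (tensor_vec B x) h) =
      m * (tensor_form A x * dot (tensor_vec B x) h) by field; lra.
    lra.
  have C1e : 0 <= C1 * e ^+ 2 by rewrite mulr_ge0 ?sqr_ge0.
  have C2e : 0 <= C2 * e ^+ 2 by rewrite mulr_ge0 ?sqr_ge0.
  rewrite ler_pdivrMl; last lra.
  rewrite !mulrDr mulrA divff ?mul1r; last by rewrite gt_eqF //; lra.
  nra.
have := NE 1%N; rewrite expr1 => ->.
set phi := _ `^ _ in hi *.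
have -> : phi *: (x + h) - x = phi *: h + (phi - 1) *: x.
  by rewrite scalerDr scalerBl scale1r addrA [phi *: h + _]addrC.
rewrite (le_trans (ler_l2normD _ _)) // (l2normZ phi) (l2normZ (phi - 1)) -/e.
apply: le_trans (power_taylor (introT andP (conj e0 e1))
  CB0 K0 ai hu hi M0 (l2norm_ge0 _) xM) _.
by rewrite -/C2 ler_wpM2r // lerDr.
Qed.
End Curve.

(** * Real sequences and backtracking *)

(** [f] is nonincreasing and bounded below, so it converges, and its successive differences dominate
    [g]. *)
Lemma nonincreasing_gap_near (R : realType) (f g : nat -> R) (L : R) :
  (forall k, 0 <= g k) -> (forall k, L <= f k) ->
  (forall k, f k.+1 <= f k - g k) ->
  forall e, 0 < e -> (\forall k \near \oo, g k < e)%classic.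
Proof.
move=> g0 fL fg e e0.
have cf : cvgn f.
  apply: nonincreasing_is_cvgn; last by exists L => _ [k _ <-].
  apply/nonincreasing_seqP => k; rewrite (le_trans (fg k)) // gerBl //.
have : (f k - f k.+1 @[k --> \oo] --> limn f - limn f)%classic.
  by apply: cvgB => //; rewrite (@cvg_shiftS _ f).
rewrite subrr => /cvgr0_norm_lt /(_ e e0); apply: filterS => k.
by move=> /(le_lt_trans (ler_norm _)); have := fg k; lra.
Qed.

(** Since [alpha < delta], the exponent of [alpha] is positive and [alpha / rho] is a larger
    candidate; accepting it would contradict maximality. *)
Lemma largest_step_lt (R : realType) (rho delta alpha : R) (P : R -> Prop) :
  0 < rho < 1 -> largest_step rho delta P alpha -> 0 < alpha < delta ->
  ~ P (alpha / rho).
Proof.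
move=> /andP[rho0 rho1] [[i ->] _ Pmax] /andP[a0 ad].
case: i a0 ad Pmax => [|i] a0 ad Pmax; first by move: ad; rewrite expr0 mulr1 ltxx.
have -> : delta * rho ^+ i.+1 / rho = delta * rho ^+ i.
  by rewrite exprSr mulrA mulfK // gt_eqF.
move=> /Pmax; rewrite exprSr mulrA ler_pMr ?leNgt ?rho1 //.
by move: a0; rewrite exprSr mulrA pmulr_lgt0.
Qed.

(** Every tail has infimum 0, so the sequence of tail infima is constant. *)
Lemma limn_einf_eq0 (R : realType) (u : nat -> R) :
  (forall k, 0 <= u k) ->
  (forall e, 0 < e -> forall K, exists2 k, (K <= k)%N & u k < e) ->
  limn_einf (fun k => (u k)%:E) = 0%:E.
Proof.
move=> u0 small; rewrite limn_einf_lim.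
suff -> : einfs (fun k => (u k)%:E) = cst 0%E by rewrite lim_cst.
apply/funext => K; apply/eqP; rewrite eq_le; apply/andP; split; last first.
  by apply: le_ereal_inf_tmp => _ [k _ <-]; rewrite lee_fin.
apply/lee_addgt0Pr => e e0; rewrite add0e.
have [k Kk ke] := small e e0 K.
apply: (@le_trans _ _ (u k)%:E); last by rewrite lee_fin ltW.
by apply: ereal_inf_lbound; exists k.
Qed.

(** [2 * M] is the fixed point of [s |-> M + s / 2], so the bound is preserved by induction. *)
Lemma half_contraction_bounded (R : realFieldType) (u : nat -> R) (M : R) K :
  0 <= M -> (forall k, (K <= k)%N -> 0 <= u k) ->
  (forall k, (K <= k)%N -> u k.+1 <= M + u k / 2) ->
  forall k, (K <= k)%N -> u k <= u K + 2 * M.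
Proof.
move=> M0 u0 uS; have uK := u0 K (leqnn K).
elim=> [|k IH]; first by rewrite leqn0 => /eqP ->; lra.
rewrite leq_eqVlt => /predU1P[<-|]; first lra.
by rewrite ltnS => Kk; have := uS k Kk; have := IH Kk; lra.
Qed.

(** * Analysis of an infinite run *)

Section Run.
Context {R : realType} {p q n : nat} (A : tensor R p.+1 n) (B : tensor R q.+1 n).
Context (rho sigma1 sigma2 delta : R) (u0 : 'cV[R]_n).
Context (x d : nat -> 'cV[R]_n) (alpha lambda : nat -> R).
Hypothesis run : FCG_run A B rho sigma1 sigma2 delta u0 x d alpha lambda.
Hypotheses (hrho : 0 < rho < 1) (hsigma1 : 0 < sigma1 < 1).
Hypotheses (hsigma2 : 0 < sigma2) (hdelta : 0 < delta).
Hypothesis (n0 : (0 < n)%N).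
Hypotheses (symA : symmetric_tensor A) (symB : symmetric_tensor B).
Hypothesis Bpos : posdef_tensor B.

Let F k := Fmap A B (x k).

(** Contracting [tensor_vec] with [z] gives back the form, and the form of [B] is 1. *)
Lemma dot_Fmap_id (z : 'cV[R]_n) :
  tensor_form B z = 1 -> dot (Fmap A B z) z = 0.
Proof.
by move=> zB; rewrite dotDl dotNl dotZl !dot_tensor_vec_id zB mulr1 subrr.
Qed.

(** Paired with the new residual, the [beta] and [theta] terms cancel: both equal the product of its
    pairings with [y] and with the old direction, over the same denominator. *)
Lemma dot_direction k : dot (F k) (d k) = - l2norm (F k) ^+ 2.
Proof.
case: k => [|k]; first by rewrite (FCG_d0 run) dotNr sqr_l2norm.
rewrite (FCG_dS run) /= -/(F k) -/(F k.+1); move: (F k) (F k.+1) => v w.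
rewrite !(dotDr, dotNr, dotZr) !sqr_l2norm; ring.
Qed.

Lemma step_gt0 k : 0 < alpha k.
Proof.
have [[i ->] _ _] := FCG_alpha run k.
by rewrite mulr_gt0 // exprn_gt0 //; case/andP: hrho.
Qed.

Lemma tensor_form_iterate k : tensor_form B (x k) = 1.
Proof.
elim: k => [|k xk].
  by rewrite (FCG_x0 run) tensor_form_normalized // Bpos ?(FCG_u0 run).
rewrite (FCG_xS run) tensor_form_normalized //; apply: Bpos; apply/eqP => z0.
(* [F k] is orthogonal to [x k] but not to [d k], so the point that is
   normalized in the update is nonzero. *)
have : dot (F k) (x k + alpha k *: d k) = 0.
  by rewrite z0 -[0](scale0r 0) dotZr mul0r.
rewrite dotDr dot_Fmap_id // add0r dotZr dot_direction => /eqP.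
rewrite mulf_eq0 gt_eqF ?step_gt0 //= oppr_eq0 expf_eq0 /= l2norm_eq0.
exact/negP/(FCG_nonstop run).
Qed.

(** By Cauchy-Schwarz, the [beta] and [theta] terms obey the same bound, which accounts for the
    factor 2. *)
Lemma direction_bound e M k :
  0 < e -> e <= l2norm (F k) -> l2norm (F k.+1) <= M ->
  l2norm (d k.+1) <=
    M + 2 * M * l2norm (F k.+1 - F k) * l2norm (d k) / e ^+ 2.
Proof.
move=> e0 eF FM; have M0 : 0 <= M := le_trans (l2norm_ge0 _) FM.
have e2 : 0 < e ^+ 2 by rewrite exprn_gt0.
have N2 : 0 < l2norm (F k) ^+ 2 by rewrite exprn_gt0 // (lt_le_trans e0).
have Ni : (l2norm (F k) ^+ 2)^-1 <= (e ^+ 2)^-1.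
  by rewrite lef_pV2 ?posrE // ler_sqr ?nnegrE ?l2norm_ge0 // ltW.
rewrite (FCG_dS run) -/(F k) -/(F k.+1); set y := F k.+1 - F k.
have bound (v w : 'cV[R]_n) :
    l2norm ((dot (F k.+1) v / l2norm (F k) ^+ 2) *: w)
      <= M * l2norm v * l2norm w / e ^+ 2.
  rewrite l2normZ normrM normfV (ger0_norm (ltW N2)) mulrAC.
  apply: ler_pM => //; rewrite ?mulr_ge0 ?l2norm_ge0 ?invr_ge0 ?(ltW N2) //.
  apply: ler_wpM2r; first exact: l2norm_ge0.
  by apply: le_trans (cauchy_schwarz _ _) _; rewrite ler_wpM2r ?l2norm_ge0.
apply: le_trans (ler_l2normB _ _) _.
apply: le_trans (lerD (ler_l2normD _ _) (lexx _)) _; rewrite l2normN.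
apply: le_trans (lerD (lerD FM (bound _ _)) (bound _ _)) _.
lra.
Qed.

(** The trial step [t = alpha k / rho] was rejected. Comparing the failed inequality with the
    expansion at [t], dividing by [t] and multiplying by [rho] gives the bound; [r * rho] keeps the
    trial move within radius [r]. *)
Lemma failed_step C r k :
  0 <= C ->
  (forall t, l2norm (t *: d k) <= r ->
     fobj A (feasible_curve B (x k) (d k) t) <=
       fobj A (x k) + t * dot (F k) (d k) + C * l2norm (t *: d k) ^+ 2) ->
  alpha k < delta -> l2norm (alpha k *: d k) <= r * rho ->
  (1 - sigma1) * rho * l2norm (F k) ^+ 2 <=
    (C + sigma2) * alpha k * l2norm (d k) ^+ 2.
Proof.
move=> C0 taylor ad adr; case/andP: hrho => rho0 rho1.
set t := alpha k / rho.
have t0 : 0 < t by rewrite divr_gt0 ?step_gt0.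
have tr : l2norm (t *: d k) <= r.
  rewrite /t mulrC -scalerA l2normZ gtr0_norm ?invr_gt0 //.
  by rewrite ler_pdivrMl // mulrC.
have := largest_step_lt hrho (FCG_alpha run k).
rewrite step_gt0 ad => /(_ isT); rewrite /sufficient_decrease -/t -/(F k).
move=> /negP; rewrite -ltNge => /lt_le_trans/(_ (taylor t tr)).
rewrite l2normZ gtr0_norm // dot_direction => ineq.
have -> : alpha k = t * rho by rewrite /t divfK // gt_eqF.
clearbody t.
have h : 0 < t * ((C + sigma2) * t * l2norm (d k) ^+ 2
                  - (1 - sigma1) * l2norm (F k) ^+ 2).
 lra.
move: h; rewrite pmulr_rgt0 // subr_gt0 => h.
have := ltW h; rewrite -(ler_pM2r rho0); lra.
Qed.

(** The quantity is the decrease guaranteed by the line search, and the objective is bounded below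
    on the bounded level set of [B]. *)
Lemma decrease_near e : 0 < e ->
  (\forall k \near \oo, sigma1 * alpha k * l2norm (F k) ^+ 2
     + sigma2 * l2norm (alpha k *: d k) ^+ 2 < e)%classic.
Proof.
move=> e0; have [M M0 xM] := posdef_level_set_bounded n0 Bpos.
have [C C0 hC] := lipschitz_on_ball_tensor_form M A.
have [s10 _] := andP hsigma1.
pose g k := sigma1 * alpha k * l2norm (F k) ^+ 2
  + sigma2 * l2norm (alpha k *: d k) ^+ 2.
apply: (@nonincreasing_gap_near _ (fun k => fobj A (x k)) g
  (- (p.+1%:R^-1 * C)) _ _ _ _ e0).
- move=> k; have a0 := step_gt0 k.
  rewrite /g addr_ge0 // mulr_ge0 ?sqr_ge0 ?(ltW hsigma2) //.
  by rewrite mulr_ge0 // ltW.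
- move=> k; rewrite -mulrN ler_wpM2l ?invr_ge0 //.
  have xk : l2norm (x k) <= M.
    exact/xM/(tensor_form_iterate).
  by have [] := hC _ _ xk xk; rewrite ler_norml => /andP[].
- move=> k; have a0 := step_gt0 k.
  have [_ + _] := FCG_alpha run k; rewrite /sufficient_decrease -(FCG_xS run).
  rewrite dot_direction /g l2normZ gtr0_norm // -/(F k).
  lra.
Qed.

Lemma residual_small e : 0 < e -> forall K, exists2 k, (K <= k)%N & l2norm (F k) < e.
Proof.
move=> e0 K; apply: contrapT => noK.
have eF k : (K <= k)%N -> e <= l2norm (F k).
  by move=> Kk; rewrite leNgt; apply/negP => ke; apply: noK; exists k.
have [rho0 rho1] := andP hrho; have [s10 s11] := andP hsigma1.
have a0 := step_gt0.
have xB := tensor_form_iterate.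
have [M M0 hM] := posdef_level_set_bounded n0 Bpos.
have xM k := hM _ (xB k).
have [C [r [C0 r0 taylor]]] := feasible_curve_taylor symA symB M0.
have [L L0 lip] := lipschitz_on_ball_Fmap M A B.
have e2 : 0 < e ^+ 2 by rewrite exprn_gt0.
(* The [sigma1] part of the decrease is at least [sigma1 * alpha k * e ^+ 2] once [K <= k]; the
   [sigma2] part controls the moves in [move_small]. *)
have alpha_small t : 0 < t -> (\forall k \near \oo, alpha k < t)%classic.
  move=> t0; have t1 : 0 < sigma1 * t * e ^+ 2 by rewrite !mulr_gt0.
  near=> k.
  have Kk : (K <= k)%N by near: k; apply: nbhs_infty_ge.
  have : sigma1 * alpha k * l2norm (F k) ^+ 2
     + sigma2 * l2norm (alpha k *: d k) ^+ 2 < sigma1 * t * e ^+ 2.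
    by near: k; apply: decrease_near.
  rewrite ltNge => h; rewrite ltNge; apply: contra h => tk.
  rewrite (@le_trans _ _ (sigma1 * alpha k * l2norm (F k) ^+ 2)) //.
    apply: ler_pM; rewrite ?sqr_ge0 ?ler_pM2l //; first by rewrite mulr_ge0 // ltW.
    by rewrite ler_sqr ?nnegrE ?l2norm_ge0 ?eF // ltW.
  by rewrite lerDl mulr_ge0 ?sqr_ge0 // ltW.
have move_small t : 0 < t ->
    (\forall k \near \oo, l2norm (alpha k *: d k) < t)%classic.
  move=> t0; have t1 : 0 < sigma2 * t ^+ 2 by rewrite mulr_gt0 // exprn_gt0.
  apply: filterS (decrease_near t1) => k; rewrite ltNge => h.
  rewrite ltNge; apply: contra h => tk.
  rewrite (@le_trans _ _ (sigma2 * l2norm (alpha k *: d k) ^+ 2)) //.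
    by rewrite ler_pM2l // ler_sqr ?nnegrE ?l2norm_ge0 // ltW.
  by rewrite lerDr mulr_ge0 ?sqr_ge0 // mulr_ge0 // ltW.
have y_small t : 0 < t ->
    (\forall k \near \oo, l2norm (F k.+1 - F k) < t)%classic.
  (* Moves below [r] admit the displacement bound [C], and [L] is the Lipschitz constant of [Fmap];
     the added 1 avoids division by zero. *)
  move=> t0; pose s := Num.min r (t / (L * C + 1)).
  have LC : 0 < L * C + 1 by rewrite ltr_wpDl ?mulr_ge0.
  have s0 : 0 < s by rewrite lt_min r0 divr_gt0.
  apply: filterS (move_small _ s0) => k; rewrite lt_min => /andP[kr kt].
  have [_ +] := @taylor _ _ _ (xB k) (xM k) (ltW kr); rewrite -(FCG_xS run) => hx.
  have [_ hF] := @lip _ _ (xM k.+1) (xM k).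
  apply: le_lt_trans hF _; apply: le_lt_trans (ler_wpM2l L0 hx) _.
  move: kt; rewrite ltr_pdivlMr // => kt; rewrite mulrA; apply: le_lt_trans kt.
  by rewrite mulrC ler_wpM2l ?l2norm_ge0 // lerDl.
have [D D1 dD] : exists2 D : R, 1 <= D &
    (\forall k \near \oo, l2norm (d k) <= D)%classic.
  (* Residual differences below this [t] make the last term of [direction_bound], with [M = L], at
     most half of [l2norm (d k)]. *)
  pose t := e ^+ 2 / (4 * (L + 1)).
  have t0 : 0 < t by rewrite divr_gt0 // mulr_gt0 //; lra.
  have [K1 _ hK1] := y_small _ t0.
  pose K2 := maxn K K1.
  have dS k : (K2 <= k)%N -> l2norm (d k.+1) <= L + l2norm (d k) / 2.
    rewrite geq_max => /andP[Kk /hK1 /= yk].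
    have [FL _] := @lip _ _ (xM k.+1) (xM k).
    apply: le_trans (direction_bound e0 (eF k Kk) FL) _.
    rewrite lerD2l ler_pdivrMr //.
    move: yk; rewrite /t ltr_pdivlMr; last by lra.
    rewrite -/(F k) -/(F k.+1); have := l2norm_ge0 (d k).
    have := l2norm_ge0 (F k.+1 - F k).
    move: (l2norm (F _ - _)) (l2norm (d k)) => y D y0 D0 hy.
    have : D * (y * (4 * (L + 1))) <= D * e ^+ 2 by rewrite ler_wpM2l // ltW.
    have := mulr_ge0 D0 y0; lra.
  exists (1 + (l2norm (d K2) + 2 * L)).
    by rewrite lerDl addr_ge0 ?l2norm_ge0 ?mulr_ge0.
  exists K2 => // k /= Kk; rewrite ler_wpDl //.
  by apply: (@half_contraction_bounded _ (fun k => l2norm (d k)));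
    rewrite // => ? _; apply: l2norm_ge0.
(* This is the lower bound on [alpha k] that [failed_step] yields from [e <= l2norm (F k)] and
   [l2norm (d k) <= D]; it contradicts [alpha_small]. *)
pose t := (1 - sigma1) * rho * e ^+ 2 / ((C + sigma2) * D ^+ 2).
have CD : 0 < (C + sigma2) * D ^+ 2.
  by rewrite mulr_gt0 ?exprn_gt0 ?ltr_wpDl // (lt_le_trans _ D1).
have t0 : 0 < t by rewrite divr_gt0 // !mulr_gt0 // subr_gt0.
near \oo%classic => k.
have Kk : (K <= k)%N by near: k; apply: nbhs_infty_ge.
have ad : alpha k < delta by near: k; apply: alpha_small.
have at_ : alpha k < t by near: k; apply: alpha_small.
have mr : l2norm (alpha k *: d k) < r * rho.
  by near: k; apply: move_small; rewrite mulr_gt0.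
have dk : l2norm (d k) <= D by near: k.
have := failed_step C0
  (fun t ht => proj1 (@taylor _ _ _ (xB k) (xM k) ht)) ad (ltW mr).
apply/negP; rewrite -ltNge.
apply: (@le_lt_trans _ _ ((C + sigma2) * D ^+ 2 * alpha k)).
  rewrite mulrAC ler_wpM2r ?(ltW (a0 k)) // ler_wpM2l ?addr_ge0 ?(ltW hsigma2) //.
  by rewrite ler_sqr ?nnegrE ?l2norm_ge0 // (le_trans _ D1).
move: at_; rewrite ltr_pdivlMr // mulrC => /lt_le_trans; apply.
rewrite ler_wpM2l ?mulr_ge0 ?subr_ge0 ?(ltW s11) ?(ltW rho0) //.
by rewrite ler_sqr ?nnegrE ?l2norm_ge0 ?eF // ltW.
Unshelve. all: by end_near.
Qed.

End Run.

(* The orders m = p.+1 and m' = q.+1 range over all positive integers. *)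
Theorem theorem2 (R : realType) (p q n : nat) (hn : (0 < n)%N)
    (A : tensor R p.+1 n) (B : tensor R q.+1 n)
    (hA : symmetric_tensor A)
    (hBsym : symmetric_tensor B) (hBpos : posdef_tensor B)
    (hm' : ~~ odd q.+1)
    (rho sigma1 sigma2 delta : R)
    (hrho : 0 < rho < 1) (hsigma1 : 0 < sigma1 < 1)
    (hsigma2 : 0 < sigma2) (hdelta : 0 < delta)
    (u0 : 'cV[R]_n) (x d : nat -> 'cV[R]_n) (alpha lambda : nat -> R)
    (hrun : FCG_run A B rho sigma1 sigma2 delta u0 x d alpha lambda) :
  limn_einf (fun k : nat => (l2norm (Fmap A B (x k)))%:E) = 0%:E.
Proof.
apply: limn_einf_eq0 => [k|]; first exact: l2norm_ge0.
exact: (residual_small hrun).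
Qed.
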